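(* Let $n\ge 2$ and let $L=L_0\oplus L_1$ be an $n$-Lie superalgebra over a field $\mathbb{F}$ of characteristic zero such that $L^2$ is finite dimensional and $L/Z(L)$ is finitely generated. Let $$\{x_1+Z(L),\ldots,x_s+Z(L),\,y_1+Z(L),\ldots,y_t+Z(L)\}$$ be a generating set of the $n$-Lie superalgebra $L/Z(L)$ such that $x_i\in L_0$ for $1\leq i\leq s$ and $y_j\in L_1$ for $1\leq j\leq t$. Then $$\dim\left(\frac{L}{Z(L)}\right)\leq \left(\sum_{i=0}^{n-1}\binom{s}{i}t^{\,n-1-i}\right)\dim L^2,$$ where $0^0=1$.
   Context: Fix a field $\mathbb{F}$ of characteristic zero and an integer $n\ge 2$. A superspace is a $\mathbb{Z}_2$-graded vector space $V=V_0\oplus V_1$; elements of $V_a$ ($a\in\mathbb{Z}_2$) are homogeneous of degree $|v|=a$. An $n$-Lie superalgebra is a superspace $L=L_0\oplus L_1$ with an $n$-linear bracket $[-,\ldots,-]:L^{\times n}\to L$ such that for homogeneous elements: (i) $|[x_1,\ldots,x_n]|=\sum_i|x_i|$ mod 2; (ii) $[x_1,\ldots,x_i,x_{i+1},\ldots,x_n]=-(-1)^{|x_i||x_{i+1}|}[x_1,\ldots,x_{i+1},x_i,\ldots,x_n]$; (iii) $[x_1,\ldots,x_{n-1},[y_1,\ldots,y_n]]=[[x_1,\ldots,x_{n-1},y_1],y_2,\ldots,y_n]+\sum_{i=2}^{n}(-1)^{(\sum_{j=1}^{i-1}|y_j|)(|x_1|+\cdots+|x_{n-1}|)}[y_1,\ldots,y_{i-1},[x_1,\ldots,x_{n-1},y_i],y_{i+1},\ldots,y_n]$.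 The center is $Z(L)=\{z\in L\mid [z,L,\ldots,L]=0\}$ and the derived superalgebra is $L^2=[L,\ldots,L]$, the span of all brackets $[x_1,\ldots,x_n]$; both are graded ideals of $L$. $\dim$ denotes total dimension. *)

(* Defs.v *)
From HB Require Import structures.
From mathcomp Require Import all_boot all_algebra.
From mathcomp Require Import boolp.

Set Implicit Arguments.
Unset Strict Implicit.
Unset Printing Implicit Defensive.

Import GRing.Theory.
Local Open Scope ring_scope.
Local Open Scope quotient_scope.

Definition upd (T : Type) (n : nat) (x : {ffun 'I_n -> T}) (i : 'I_n) (a : T) :
    {ffun 'I_n -> T} :=
  [ffun k => if k == i then a else x k].

(* The group Z/2 is [bool] ([false] is even, [true] is odd); degrees are      *)
(* coerced to [nat] in signs and sums.  In the super Jacobi identity          *)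
(* [bracket_jacobi], [l] is the last slot, so [upd x l b] is the argument list *)
(* (x_1, ..., x_(n-1), b) and the value of [x] at [l] plays no role.  The      *)
(* i = 0 summand has sign +1 since its sum of degrees of y is empty.           *)
HB.mixin Record isNLieSuperalgebra (F : fieldType) (n : nat) L
    of GRing.Lmodule F L := {
  homog : bool -> {pred L};
  homog_submod : forall a : bool, submod_closed (homog a);
  homog_dec : forall v : L, exists v0 v1 : L,
    [/\ v0 \in homog false, v1 \in homog true & v = v0 + v1];
  homog_disj : forall v : L, v \in homog false -> v \in homog true -> v = 0;
  bracket : {ffun 'I_n -> L} -> L;
  bracket_linear : forall (x : {ffun 'I_n -> L}) (i : 'I_n) (a : F) (u v : L),
    bracket (upd x i (a *: u + v))
    = a *: bracket (upd x i u) + bracket (upd x i v);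
  bracket_degree : forall (d : 'I_n -> bool) (x : {ffun 'I_n -> L}),
    (forall i, x i \in homog (d i)) ->
    bracket x \in homog (odd (\sum_(i < n) d i));
  bracket_skew : forall (d : 'I_n -> bool) (x : {ffun 'I_n -> L}) (i j : 'I_n),
    (forall k, x k \in homog (d k)) -> j = i.+1 :> nat ->
    bracket x
    = - ((-1) ^+ (d i * d j)%N *: bracket (upd (upd x i (x j)) j (x i)));
  bracket_jacobi : forall (dx dy : 'I_n -> bool) (x y : {ffun 'I_n -> L})
      (l : 'I_n),
    (forall k, x k \in homog (dx k)) -> (forall k, y k \in homog (dy k)) ->
    l.+1 = n ->
    bracket (upd x l (bracket y))
    = \sum_(i < n)
        (-1) ^+ ((\sum_(j < n | (j < i)%N) dy j) * (\sum_(j < n | j != l) dx j))%N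
        *: bracket (upd y i (bracket (upd x l (y i))))
}.

#[short(type="nLieSuperalgType")]
HB.structure Definition NLieSuperalgebra (F : fieldType) (n : nat) :=
  { L of GRing.Lmodule F L & isNLieSuperalgebra F n L }.

Section Notions.
Variables (F : fieldType) (n : nat) (L : nLieSuperalgType F n).

Definition center : {pred L} :=
  [pred z : L | `[< forall (x : {ffun 'I_n -> L}) (i : 'I_n),
                      i = 0 :> nat -> bracket (upd x i z) = 0 >]].

Definition derived : {pred L} :=
  [pred v : L | `[< exists (m : nat) (c : 'I_m -> F)
                      (x : 'I_m -> {ffun 'I_n -> L}),
                      v = \sum_(k < m) c k *: bracket (x k) >]].

Definition sub_superalgebra (S : {pred L}) : Prop :=
  [/\ submod_closed S,
      forall v0 v1 : L, v0 \in homog false -> v1 \in homog true ->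
        v0 + v1 \in S -> v0 \in S /\ v1 \in S
    & forall x : {ffun 'I_n -> L}, (forall i, x i \in S) -> bracket x \in S].

Definition generates (G : L -> Prop) : Prop :=
  forall S : {pred L}, sub_superalgebra S -> (forall g, G g -> g \in S) ->
  forall v, v \in S.

Definition finitely_generated : Prop :=
  exists (m : nat) (g : 'I_m -> L), generates (fun v => exists i, v = g i).

End Notions.

Arguments center {F n} L _.
Arguments derived {F n} L _.
Arguments finitely_generated {F n} L.

Definition has_dim (F : fieldType) (V : lmodType F) (U : {pred V}) (d : nat) :
    Prop :=
  exists b : 'I_d -> V,
    (forall c : 'I_d -> F, \sum_(i < d) c i *: b i = 0 -> forall i, c i = 0)
    /\ (forall v : V, v \in U <-> exists c : 'I_d -> F, v = \sum_(i < d) c i *: b i).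

Section CenterTheory.
Variables (F : fieldType) (n : nat) (L : nLieSuperalgType F n).
Implicit Types (x y : {ffun 'I_n -> L}) (i j : 'I_n) (z v : L).

Lemma centerP z :
  reflect (forall x i, i = 0 :> nat -> bracket (upd x i z) = 0) (z \in center L).
Proof. exact: asboolP. Qed.

Lemma upd_id (T : Type) (w : {ffun 'I_n -> T}) i : upd w i (w i) = w.
Proof. by apply/ffunP => k; rewrite ffunE; case: eqP => [->|]. Qed.

Lemma upd_upd (T : Type) (w : {ffun 'I_n -> T}) i (a b : T) :
  upd (upd w i a) i b = upd w i b.
Proof. by apply/ffunP => k; rewrite !ffunE; case: eqP. Qed.

Lemma updC (T : Type) (w : {ffun 'I_n -> T}) i j (a b : T) :
  i != j -> upd (upd w i a) j b = upd (upd w j b) i a.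
Proof.
move=> ij; apply/ffunP => k; rewrite !ffunE.
by case: (k =P j) => // ->; rewrite eq_sym (negPf ij).
Qed.

Lemma bracketD x i u v :
  bracket (upd x i (u + v)) = bracket (upd x i u) + bracket (upd x i v).
Proof. by have := bracket_linear x i 1 u v; rewrite !scale1r. Qed.

Lemma bracket0 x i : bracket (upd x i 0) = 0.
Proof. by have := bracketD x i 0 0; rewrite addr0 => /eqP; rewrite -subr_eq subrr => /eqP. Qed.

Lemma homog0 (a : bool) : (0 : L) \in homog a.
Proof. by case: (@homog_submod F n L a). Qed.

Lemma homogB (a : bool) (u v : L) :
  u \in homog a -> v \in homog a -> u - v \in homog a.
Proof.
by case: (@homog_submod F n L a) => _ lin uA vA; rewrite addrC -scaleN1r lin.
Qed.

Lemma homog_sum0 (a b : bool) (u v : L) :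
  u \in homog a -> v \in homog b -> a != b -> u + v = 0 -> u = 0 /\ v = 0.
Proof.
have main p q : p \in homog false -> q \in homog true -> p + q = 0 ->
    p = 0 /\ q = 0 :> L.
  move=> pA qB /eqP; rewrite addr_eq0 => /eqP pq.
  have q0 : q = 0.
    apply: homog_disj => //; rewrite -[q]opprK -pq -sub0r.
    exact: homogB (homog0 _) pA.
  by rewrite pq q0 oppr0.
move=> uA vB; case: a uA; case: b vB => // vB uA _ uv.
  by rewrite addrC in uv; case: (main _ _ vB uA uv).
exact: main uv.
Qed.

Lemma homog_ext z i :
  (forall (d : 'I_n -> bool) x, (forall k, x k \in homog (d k)) ->
     bracket (upd x i z) = 0) ->
  forall x, bracket (upd x i z) = 0.
Proof.
move=> H.
pose hb x (k : 'I_n) := (x k \in homog false) || (x k \in homog true).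
suff main (m : nat) x : (forall k : 'I_n, (m <= k)%N -> hb x k) ->
    bracket (upd x i z) = 0.
  by move=> x; apply: (main n) => k; rewrite leqNgt ltn_ord.
elim: m x => [|m IH] x hx.
  apply: (H (fun k => x k \in homog true)) => k.
  by have := hx k (leq0n _); rewrite /hb; case: (boolP (x k \in homog true)); rewrite ?orbF.
have [mn|nm] := ltnP m n; last first.
  by apply: IH => k /(leq_trans nm); rewrite leqNgt ltn_ord.
pose k0 := Ordinal mn.
have hupd (a : bool) v : v \in homog a -> forall k : 'I_n, (m <= k)%N ->
    hb (upd x k0 v) k.
  move=> va k mk; rewrite /hb ffunE; case: (k =P k0) => [_|/eqP kk0].
    by case: a va => ->; rewrite ?orbT.
  by apply: hx; rewrite ltn_neqAle mk andbT eq_sym.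
have [ik|ik] := eqVneq k0 i.
  rewrite -(upd_upd x i 0) -{1}ik; apply: IH.
  exact: hupd (homog0 false).
have [v0 [v1 [h0 h1 e]]] := @homog_dec F n L (x k0).
rewrite -(upd_id x k0) e updC // bracketD -!(updC _ _ _ ik).
by rewrite (IH _ (hupd _ _ h0)) (IH _ (hupd _ _ h1)) addr0.
Qed.

Lemma center_submod_closed : submod_closed (center L).
Proof.
split; first by apply/centerP => x i _; rewrite bracket0.
move=> a u v /centerP uZ /centerP vZ; apply/centerP => x i i0.
by rewrite bracket_linear uZ // vZ // scaler0 addr0.
Qed.

HB.instance Definition _ :=
  GRing.isSubmodClosed.Build F L (center L) center_submod_closed.

Lemma center_graded (v0 v1 : L) :
  v0 \in homog false -> v1 \in homog true -> v0 + v1 \in center L ->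
  v0 \in center L /\ v1 \in center L.
Proof.
move=> h0 h1 /centerP vZ.
suff main (d : 'I_n -> bool) x i : i = 0 :> nat ->
    (forall k, x k \in homog (d k)) ->
    bracket (upd x i v0) = 0 /\ bracket (upd x i v1) = 0.
  by split; apply/centerP => x i i0; apply: homog_ext => d y hy;
     have [] := main d y i i0 hy.
move=> i0 hx.
pose dd (b : bool) k := if k == i then b else d k.
have hd b v : v \in homog b -> forall k, upd x i v k \in homog (dd b k).
  by move=> vb k; rewrite ffunE /dd; case: eqP.
have hsum := vZ x i i0; rewrite bracketD in hsum.
suff par : odd (\sum_(k < n) dd false k) != odd (\sum_(k < n) dd true k).
  have hb0 := bracket_degree _ _ (hd _ _ h0); have hb1 := bracket_degree _ _ (hd _ _ h1).
  exact: homog_sum0 hb0 hb1 par hsum.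
have e b : (\sum_(k < n) dd b k = b + \sum_(k < n | k != i) d k)%N.
  rewrite (bigD1 i) //= {1}/dd eqxx; congr addn.
  by apply: eq_bigr => k /negPf ki; rewrite /dd ki.
by rewrite !e !oddD /=; case: (odd _).
Qed.

Lemma center_slot z x i : z \in center L -> bracket (upd x i z) = 0.
Proof.
suff main (a : bool) v : v \in homog a -> v \in center L ->
    forall (m : nat) (j : 'I_n), j = m :> nat ->
    forall y, bracket (upd y j v) = 0.
  move=> zZ; have [v0 [v1 [h0 h1 e]]] := @homog_dec F n L z.
  rewrite e in zZ; have [z0 z1] := center_graded h0 h1 zZ.
  by rewrite e bracketD (main _ _ h0 z0 i) // (main _ _ h1 z1 i) // addr0.
move=> va vZ; elim=> [|m IH] j jm; first by move=> y; apply: (centerP _ vZ).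
apply: homog_ext => d y hy.
have mn : (m < n)%N by apply: leq_trans (ltn_ord j); rewrite jm.
pose i0 := Ordinal mn.
pose dd k := if k == j then a else d k.
have hd k : upd y j v k \in homog (dd k).
  by rewrite ffunE /dd; case: eqP.
have ij : i0 != j by apply/eqP => /(congr1 val) /= /eqP; rewrite jm ltn_eqF.
rewrite (bracket_skew _ _ i0 j hd) //.
have -> : upd y j v j = v by rewrite ffunE eqxx.
by rewrite updC // IH // scaler0 oppr0.
Qed.

Lemma bracket_center x y :
  (forall i, x i - y i \in center L) -> bracket x = bracket y.
Proof.
move=> xy.
pose h (m : nat) : {ffun 'I_n -> L} := [ffun k : 'I_n => if (k < m)%N then x k else y k].
have -> : x = h n by apply/ffunP => k; rewrite ffunE ltn_ord.
have -> : y = h 0%N by apply/ffunP => k; rewrite ffunE.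
suff main m : (m <= n)%N -> bracket (h m) = bracket (h 0%N) by apply: main.
elim: m => // m IH mn; rewrite -IH ?(ltnW mn) //.
pose k0 := Ordinal mn.
have -> : h m.+1 = upd (h m) k0 ((x k0 - y k0) + y k0).
  apply/ffunP => k; rewrite !ffunE subrK ltnS leq_eqVlt.
  by rewrite -[k == k0]/(k == m :> nat); case: eqP => //= km; congr (x _); apply: val_inj.
rewrite bracketD center_slot // add0r; congr bracket.
have -> : y k0 = h m k0 by rewrite ffunE ltnn.
exact: upd_id.
Qed.

End CenterTheory.

Definition center_quot (F : fieldType) (n : nat) (L : nLieSuperalgType F n) :=
  Quotient.quot (center L).

Definition center_proj (F : fieldType) (n : nat) (L : nLieSuperalgType F n)
  (v : L) : center_quot L := \pi_(Quotient.quot (center L)) v.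

Section CenterQuotient.
Variables (F : fieldType) (n : nat) (L : nLieSuperalgType F n).
Local Notation Q := (center_quot L).
Local Notation pi := (@center_proj F n L).

HB.instance Definition _ := GRing.Zmodule.on Q.

Definition center_lift (q : Q) : L := repr (q : Quotient.quot (center L)).

Lemma center_liftK : cancel center_lift pi.
Proof. by move=> q; rewrite /center_proj /center_lift reprK. Qed.

Lemma center_projP u v : (pi u = pi v) <-> (u - v \in center L).
Proof. by rewrite /center_proj Quotient.idealrBE; split => /eqP. Qed.

Lemma center_projD u v : pi (u + v) = pi u + pi v.
Proof. by rewrite /center_proj; exact: (raddfD (\pi_(Quotient.quot (center L)))). Qed.

Definition quot_scale (a : F) (q : Q) : Q := pi (a *: center_lift q).

Lemma center_projZ_subproof a v : pi (a *: v) = quot_scale a (pi v).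
Proof.
apply/center_projP; rewrite -scalerBr rpredZ //.
by apply/center_projP; rewrite center_liftK.
Qed.

Fact quot_scaleA a b q : quot_scale a (quot_scale b q) = quot_scale (a * b) q.
Proof. by rewrite -[q]center_liftK -!center_projZ_subproof scalerA. Qed.
Fact quot_scale1 : left_id 1 quot_scale.
Proof. by move=> q; rewrite -[q]center_liftK -!center_projZ_subproof scale1r. Qed.
Fact quot_scaleDr : right_distributive quot_scale +%R.
Proof.
move=> a p q; rewrite -[p]center_liftK -[q]center_liftK -center_projD.
by rewrite -!center_projZ_subproof scalerDr center_projD.
Qed.
Fact quot_scaleDl q : {morph quot_scale^~ q : a b / a + b}.
Proof.
by move=> a b; rewrite -[q]center_liftK -!center_projZ_subproof scalerDl center_projD.
Qed.

HB.instance Definition _ := GRing.Zmodule_isLmodule.Build F Q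
  quot_scaleA quot_scale1 quot_scaleDr quot_scaleDl.

Lemma center_projZ a v : pi (a *: v) = a *: pi v.
Proof. exact: center_projZ_subproof. Qed.

Fact center_proj_linear : linear pi.
Proof. by move=> a u v; rewrite center_projD center_projZ. Qed.

HB.instance Definition _ := GRing.isLinear.Build F L Q *:%R pi center_proj_linear.

Definition quot_homog (a : bool) : {pred Q} :=
  [pred q : Q | `[< exists2 v : L, v \in homog a & q = pi v >]].

Definition quot_bracket (x : {ffun 'I_n -> Q}) : Q :=
  pi (bracket [ffun i => center_lift (x i)]).

Lemma quot_homogP a q :
  reflect (exists2 v : L, v \in homog a & q = pi v) (q \in quot_homog a).
Proof. exact: asboolP. Qed.

Definition map_proj (x : {ffun 'I_n -> L}) : {ffun 'I_n -> Q} :=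
  [ffun i => pi (x i)].

Lemma map_proj_upd x i v : map_proj (upd x i v) = upd (map_proj x) i (pi v).
Proof. by apply/ffunP => k; rewrite !ffunE; case: eqP. Qed.

Lemma quot_bracketE x : quot_bracket (map_proj x) = pi (bracket x).
Proof.
congr pi; apply: bracket_center => i; rewrite !ffunE.
by apply/center_projP; rewrite center_liftK.
Qed.

Lemma map_proj_lift (x : {ffun 'I_n -> Q}) :
  x = map_proj [ffun i => center_lift (x i)].
Proof. by apply/ffunP => k; rewrite !ffunE center_liftK. Qed.

Lemma map_proj_homog (d : 'I_n -> bool) (x : {ffun 'I_n -> Q}) :
  (forall k, x k \in quot_homog (d k)) ->
  exists2 y : {ffun 'I_n -> L}, forall k, y k \in homog (d k) & x = map_proj y.
Proof.
move=> hx.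
have /choice[f hf] k : exists v : L, v \in homog (d k) /\ x k = pi v.
  by have /quot_homogP[v vk e] := hx k; exists v.
exists [ffun k => f k] => [k|]; first by rewrite ffunE; case: (hf k).
by apply/ffunP => k; rewrite !ffunE; case: (hf k).
Qed.

Fact quot_homog_submod a : submod_closed (quot_homog a).
Proof.
split; first by apply/quot_homogP; exists 0; rewrite ?homog0 // linear0.
move=> c p q /quot_homogP[u ua ->] /quot_homogP[v va ->].
apply/quot_homogP; exists (c *: u + v); last by rewrite linearP.
by case: (@homog_submod F n L a) => _; apply.
Qed.

Fact quot_homog_dec q : exists q0 q1 : Q,
  [/\ q0 \in quot_homog false, q1 \in quot_homog true & q = q0 + q1].
Proof.
have [v0 [v1 [h0 h1 e]]] := @homog_dec F n L (center_lift q).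
exists (pi v0), (pi v1); split; last by rewrite -center_projD -e center_liftK.
- by apply/quot_homogP; exists v0.
- by apply/quot_homogP; exists v1.
Qed.

Fact quot_homog_disj q : q \in quot_homog false -> q \in quot_homog true -> q = 0.
Proof.
move=> /quot_homogP[u hu ->] /quot_homogP[v hv /center_projP uv].
have hv' : - v \in homog true by rewrite -sub0r homogB ?homog0.
have [uZ _] := center_graded hu hv' uv.
by rewrite -(linear0 pi); apply/center_projP; rewrite subr0.
Qed.

Fact quot_bracket_linear (x : {ffun 'I_n -> Q}) i a u v :
  quot_bracket (upd x i (a *: u + v))
  = a *: quot_bracket (upd x i u) + quot_bracket (upd x i v).
Proof.
rewrite (map_proj_lift x) -[u]center_liftK -[v]center_liftK -linearP.
by rewrite -!map_proj_upd !quot_bracketE bracket_linear linearP.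
Qed.

Fact quot_bracket_degree (d : 'I_n -> bool) (x : {ffun 'I_n -> Q}) :
  (forall i, x i \in quot_homog (d i)) ->
  quot_bracket x \in quot_homog (odd (\sum_(i < n) d i)).
Proof.
move=> /map_proj_homog[y hy ->]; rewrite quot_bracketE; apply/quot_homogP.
by exists (bracket y) => //; apply: bracket_degree.
Qed.

Fact quot_bracket_skew (d : 'I_n -> bool) (x : {ffun 'I_n -> Q}) (i j : 'I_n) :
  (forall k, x k \in quot_homog (d k)) -> j = i.+1 :> nat ->
  quot_bracket x
  = - ((-1) ^+ (d i * d j)%N *: quot_bracket (upd (upd x i (x j)) j (x i))).
Proof.
move=> /map_proj_homog[y hy ->] ij.
have e k : map_proj y k = pi (y k) by rewrite ffunE.
by rewrite !e -!map_proj_upd !quot_bracketE (bracket_skew _ _ _ _ hy ij) linearN linearZ.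
Qed.

Fact quot_bracket_jacobi (dx dy : 'I_n -> bool) (x y : {ffun 'I_n -> Q})
    (l : 'I_n) :
  (forall k, x k \in quot_homog (dx k)) ->
  (forall k, y k \in quot_homog (dy k)) -> l.+1 = n ->
  quot_bracket (upd x l (quot_bracket y))
  = \sum_(i < n)
      (-1) ^+ ((\sum_(j < n | (j < i)%N) dy j) * (\sum_(j < n | j != l) dx j))%N
      *: quot_bracket (upd y i (quot_bracket (upd x l (y i)))).
Proof.
move=> /map_proj_homog[x' hx ->] /map_proj_homog[y' hy ->] ln.
rewrite quot_bracketE -map_proj_upd quot_bracketE (bracket_jacobi _ _ _ _ _ hx hy ln).
rewrite linear_sum; apply: eq_bigr => i _; rewrite linearZ /=; congr (_ *: _).
have -> : map_proj y' i = pi (y' i) by rewrite ffunE.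
by rewrite -map_proj_upd quot_bracketE -map_proj_upd quot_bracketE.
Qed.

HB.instance Definition _ := isNLieSuperalgebra.Build F n Q
  quot_homog_submod quot_homog_dec quot_homog_disj quot_bracket_linear
  quot_bracket_degree quot_bracket_skew quot_bracket_jacobi.

End CenterQuotient.

(* Main.v *)
(* The map sending z to the brackets [z, w_1, ..., w_(n-1)], one for each normal  *)
(* word w (the x_i over a subset of the even generators, then any word in the y_j), *)
(* has kernel Z(L), so it embeds L / Z(L) into a power of L^2 with one factor per  *)
(* normal word.  Indeed, up to sign every bracket of generators is on a normal     *)
(* word, or repeats an even generator and vanishes as char F <> 2.  And if z is    *)
(* killed by all words in generators, generators can be replaced one at a time by  *)
(* arbitrary homogeneous elements: with the other slots fixed, the bracket is a    *)
(* superderivation, whose kernel is a subalgebra containing Z(L) and the generators. *)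

Require Import Defs.
From HB Require Import structures.
From mathcomp Require Import all_boot all_algebra.
From mathcomp Require Import fingroup perm boolp.

Set Implicit Arguments.
Unset Strict Implicit.
Unset Printing Implicit Defensive.

Import GRing.Theory.
Local Open Scope ring_scope.

(** The argument only asks whether brackets vanish, so accumulated signs never matter: vanishing on
    homogeneous arguments survives permuting them ([sbracket_perm0]). Moving a slot to the end makes
    the bracket a superderivation in it ([derivation_ker_sub]), and generation of L/Z(L) then frees
    the slots one at a time ([killed_by_generators_center]). Sorting words and discarding repeated
    even letters ([sbracket_repeat]) reduces the test for centrality to normal words
    ([killed_by_normal_words_center]). Coordinates of the values in L^2 turn this test into an
    injective linear map on L/Z(L), whose target has the bound as its dimension. *)

(** * Linear algebra: bases from an injection, coordinates on a subspace *)

Lemma injective_has_dim (F : fieldType) (V : lmodType F) (K : nat)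
    (f : {linear V -> 'rV[F]_K}) :
  injective f ->
  exists m : nat, has_dim [pred v : V | true] m /\ (m <= K)%N.
Proof.
move=> f_inj.
pose mx r (v : 'I_r -> V) : 'M[F]_(r, K) := \matrix_i f (v i).
have mulmxE r (v : 'I_r -> V) (c : 'rV_r) : c *m mx r v = f (\sum_i c 0 i *: v i).
  by rewrite mulmx_sum_row linear_sum; apply: eq_bigr => i _; rewrite linearZ rowK.
(* [V] is not yet known to be finite dimensional. Families with independent images have size at most
   [K], so a largest one exists; it spans, since prepending a vector outside its span would give a
   larger one. *)
pose P r := `[< exists v : 'I_r -> V, row_free (mx r v) >].
have exP : exists r, P r.
  by exists 0%N; apply/asboolP; exists (fun=> 0); rewrite /row_free flatmx0 mxrank0.
have leP r : P r -> (r <= K)%N.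
  by move=> /asboolP[v /eqP <-]; apply: rank_leq_col.
case: (ex_maxnP exP leP) => m /asboolP[v v_free] m_max.
exists m; split; last by apply: leP; apply/asboolP; exists v.
exists v; split => [c c0 i|u].
  have : (\row_j c j) *m mx m v = 0 *m mx m v.
    rewrite mul0mx mulmxE; under eq_bigr do rewrite mxE.
    by rewrite c0 linear0.
  by move=> /(row_free_inj v_free)/rowP/(_ i); rewrite !mxE.
split=> // _.
have /submxP[c fu] : (f u <= mx m v)%MS.
  apply: contraT => u_notin; have := m_max m.+1; rewrite ltnn; apply.
  pose v' (i : 'I_(1 + m)) : V := if split i is inr j then v j else u.
  apply/asboolP; exists v'.
  have -> : mx (1 + m)%N v' = col_mx (f u) (mx m v).
    apply/row_matrixP => i; rewrite rowK /v'; case: (splitP i) => j ij.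
      rewrite (_ : i = lshift m j); last exact: val_inj.
      by rewrite rowKu ord1 row_id.
    rewrite (_ : i = rshift 1 j); last exact: val_inj.
    by rewrite rowKd rowK.
  have := addsmxE (f u) (mx m v); rewrite /row_free eqn_leq rank_leq_row => -[<- _].
  have : (mx m v < f u + mx m v)%MS.
    by rewrite ltmxE addsmxSr addsmx_sub submx_refl andbT.
  by rewrite ltmxErank (eqP v_free) => /andP[].
exists (c 0); apply: f_inj.
by rewrite fu mulmxE.
Qed.

(** [U] is only a predicate, so coordinates are chosen on [U] and set to 0 elsewhere; linearity on
    [U] comes from their uniqueness. *)
Lemma has_dim_coord (F : fieldType) (V : lmodType F) (U : {pred V}) d :
  has_dim U d ->
  exists co : V -> 'rV[F]_d,
    (forall a u v, u \in U -> v \in U -> co (a *: u + v) = a *: co u + co v) /\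
    (forall u, u \in U -> co u = 0 -> u = 0).
Proof.
case=> b [b_free b_span].
have /choice[co coE] v : exists c : 'rV[F]_d, v \in U ->
    v = \sum_i c 0 i *: b i.
  have [/b_span[c vc]|vU] := boolP (v \in U); last by exists 0.
  by exists (\row_i c i) => _; rewrite vc; apply: eq_bigr => i _; rewrite mxE.
exists co; split=> [a u v uU vU|u uU cu0]; last first.
  by rewrite (coE u uU) cu0 big1 // => i _; rewrite mxE scale0r.
have lin : a *: u + v = \sum_i (a *: co u + co v) 0 i *: b i.
  rewrite [u in LHS]coE // [v in LHS]coE // scaler_sumr -big_split.
  by apply: eq_bigr => i _; rewrite !mxE scalerDl scalerA.
have wU : a *: u + v \in U by apply/b_span; exists ((a *: co u + co v) 0).
apply/rowP => i; apply/eqP; rewrite -subr_eq0; apply/eqP.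
apply: (b_free (fun i => co (a *: u + v) 0 i - (a *: co u + co v) 0 i)).
under eq_bigr do rewrite scalerBl.
by rewrite sumrB -coE // -lin subrr.
Qed.

(** * Vanishing of brackets: parity and permutation of arguments *)

Section Superalgebra.
Variables (F : fieldType) (n : nat) (L : nLieSuperalgType F n).
Implicit Types (w : {ffun 'I_n -> L}) (i j l : 'I_n) (u v z : L) (r s : seq L).

Definition is_homog : {pred L} :=
  [pred v | (v \in homog false) || (v \in homog true)].

Lemma is_homogP v : reflect (exists a : bool, v \in homog a) (v \in is_homog).
Proof.
apply: (iffP orP) => [[h|h]|[[] h]]; by [exists false|exists true|right|left].
Qed.

Lemma all_homog_cons v s :
  all is_homog (v :: s) = (v \in is_homog) && all is_homog s.
Proof. by []. Qed.

Lemma homog_degrees w : (forall k, w k \in is_homog) ->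
  exists d : 'I_n -> bool, forall k, w k \in homog (d k).
Proof.
move=> hw; have /choice[d hd] k : exists a : bool, w k \in homog a.
  exact/is_homogP.
by exists d.
Qed.

Lemma upd_homog w l (d : 'I_n -> bool) a u :
  (forall k, k != l -> w k \in homog (d k)) -> u \in homog a ->
  forall k, upd w l u k \in homog (if k == l then a else d k).
Proof. by move=> hw hu k; rewrite ffunE; case: eqVneq => [_|/hw]. Qed.

(** The two brackets have opposite parities, so they cannot cancel each other. *)
Lemma bracket_homog_eq0 w l v0 v1 :
  (forall k, k != l -> w k \in is_homog) ->
  v0 \in homog false -> v1 \in homog true ->
  bracket (upd w l (v0 + v1)) = 0 ->
  bracket (upd w l v0) = 0 /\ bracket (upd w l v1) = 0.
Proof.
move=> hw h0 h1; rewrite bracketD.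
have /choice[d hd] k : exists a : bool, k != l -> w k \in homog a.
  by case: eqVneq => [_|/hw/is_homogP[a]]; [exists false|exists a].
have b0 := bracket_degree _ _ (upd_homog hd h0).
have b1 := bracket_degree _ _ (upd_homog hd h1).
apply: homog_sum0 b0 b1 _.
have e (b : bool) : (\sum_(k < n) (if k == l then b else d k)
    = b + \sum_(k < n | k != l) d k)%N.
  by rewrite (bigD1 l) //= eqxx; congr addn; apply: eq_bigr => k /negPf ->.
by rewrite !e !oddD /=; case: (odd _).
Qed.

Definition swap w i j : {ffun 'I_n -> L} := [ffun k => w (tperm i j k)].

(** Super skew symmetry gives adjacent transpositions up to a sign, which does not affect vanishing.
    The others follow by induction on the distance, conjugating (i+1 j) by (i i+1). *)
Lemma bracket_swap0 w i j : (forall k, w k \in is_homog) ->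
  bracket w = 0 -> bracket (swap w i j) = 0.
Proof.
have adj w' i' j' : (forall k, w' k \in is_homog) -> j' = i'.+1 :> nat ->
    bracket w' = 0 -> bracket (swap w' i' j') = 0.
  move=> /homog_degrees[d hd] ij; rewrite (bracket_skew _ _ i' j' hd) //.
  move=> /eqP; rewrite oppr_eq0 scaler_eq0 signr_eq0 /= => /eqP <-.
  congr bracket; apply/ffunP => k; rewrite !ffunE.
  case: tpermP => [->|->|/eqP/negPf-> /eqP/negPf->] //; rewrite ?eqxx //.
  by case: eqP => // ->.
have lt m w' i' j' : (forall k, w' k \in is_homog) ->
    j' = (i' + m.+1)%N :> nat -> bracket w' = 0 -> bracket (swap w' i' j') = 0.
  elim: m w' i' j' => [|m IH] w' i' j' hw ij b0.
    by apply: adj; rewrite // ij addn1.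
  have i1n : (i'.+1 < n)%N.
    by apply: leq_ltn_trans (ltn_ord j'); rewrite ij addnS ltnS leq_addr.
  pose i1 := Ordinal i1n.
  have hs w2 a b : (forall k, w2 k \in is_homog) -> forall k, swap w2 a b k \in is_homog.
    by move=> h k; rewrite ffunE.
  have -> : swap w' i' j' = swap (swap (swap w' i' i1) i1 j') i' i1.
    apply/ffunP => k; rewrite !ffunE; congr (w' _).
    rewrite -2!permM; congr (fun_of_perm _ k).
    have -> : tperm i' j' = (tperm i1 j' ^ tperm i' i1)%g.
      rewrite tpermJ tpermR tpermD //; apply/eqP => /(congr1 val) /= /eqP.
        by rewrite ij -[X in X == _]addn0 eqn_add2l.
      by rewrite ij -addn1 eqn_add2l.
    by rewrite /conjg tpermV mulgA.
  apply: (adj) => //; first exact/hs/hs.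
  apply: IH; [exact: hs|by rewrite /= ij addSnnS|exact: adj].
have swapC a b : swap w a b = swap w b a by rewrite /swap tpermC.
move=> hw b0; case: (ltngtP i j) => ij.
- by apply: (lt (j - i.+1)%N) => //; rewrite -addSnnS subnKC.
- by rewrite swapC; apply: (lt (i - j.+1)%N) => //; rewrite -addSnnS subnKC.
- have -> : swap w i j = w; last by [].
  by apply/ffunP => k; rewrite ffunE (val_inj ij) tperm1 perm1.
Qed.

Lemma bracket_perm0 w (p : 'S_n) : (forall k, w k \in is_homog) ->
  bracket w = 0 -> bracket [ffun k => w (p k)] = 0.
Proof.
case: (prod_tpermP p) => ts -> _ hw b0.
elim: ts w hw b0 => [|[i j] ts IH] w hw b0.
  by rewrite (_ : finfun _ = w) //; apply/ffunP => k; rewrite ffunE big_nil perm1.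
rewrite (_ : finfun _ = swap [ffun k => w ((\prod_(t <- ts) tperm t.1 t.2)%g k)] i j).
  by apply: bracket_swap0 (IH w hw b0) => k; rewrite ffunE.
by apply/ffunP => k; rewrite !ffunE big_cons permM.
Qed.

(* Lists are padded with 0 or truncated to length [n]. *)
Definition sbracket s : L := bracket [ffun k : 'I_n => nth 0 s k].

Lemma sbracket_perm0 s1 s2 : all is_homog s1 -> size s1 = n ->
  perm_eq s1 s2 -> sbracket s1 = 0 -> sbracket s2 = 0.
Proof.
move=> h1 sz1 /[dup] /perm_size; rewrite sz1 => /esym sz2.
pose t1 : n.-tuple L := Tuple (introT eqP sz1).
rewrite perm_sym -[s1]/(tval t1).
move=> /tuple_permP[p s2E] b0.
have := @bracket_perm0 [ffun k : 'I_n => nth 0 s1 k] p; rewrite /sbracket.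
have -> : [ffun k => [ffun k : 'I_n => nth 0 s1 k] (p k)]
    = [ffun k : 'I_n => nth 0 s2 k] :> {ffun 'I_n -> L}.
  apply/ffunP => k; rewrite !ffunE s2E (nth_map k) ?size_enum_ord //.
  by rewrite nth_ord_enum (tnth_nth 0).
by apply=> // k; rewrite ffunE; apply: (allP h1); rewrite mem_nth ?sz1.
Qed.

Lemma sbracket_upd s i u : sbracket (set_nth 0 s i u)
  = bracket (upd [ffun k : 'I_n => nth 0 s k] i u).
Proof. by congr bracket; apply/ffunP => k; rewrite !ffunE nth_set_nth. Qed.

Lemma bracketE w : bracket w = sbracket (codom w).
Proof.
congr bracket; apply/ffunP => k; rewrite ffunE codomE (nth_map k) ?size_enum_ord //.
by rewrite nth_ord_enum.
Qed.

(** * From generators of L/Z(L) to all of L *)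

(** With the last slot free, the Jacobi identity makes the bracket a superderivation: each summand
    for [bracket y] contains the image of some [y i], which is 0. *)
Lemma derivation_ker_sub w l : l.+1 = n -> (forall k, w k \in is_homog) ->
  sub_superalgebra [pred u | bracket (upd w l u) == 0].
Proof.
move=> ln hw; split.
- split=> [|a u v]; rewrite !inE ?bracket0 // => /eqP u0 /eqP v0.
  by rewrite bracket_linear u0 v0 scaler0 addr0.
- move=> v0 v1 h0 h1 /eqP b0.
  have [b00 b01] := bracket_homog_eq0 (fun k _ => hw k) h0 h1 b0.
  by rewrite !inE b00 b01.
move=> x xS; apply/eqP.
(* The Jacobi identity needs homogeneous arguments, so the first [m] slots are split one by one;
   both components stay in the kernel because it is graded. *)
suff main (m : nat) (y : {ffun 'I_n -> L}) : (forall k : 'I_n, bracket (upd w l (y k)) = 0) ->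
    (forall k : 'I_n, (m <= k)%N -> y k \in is_homog) ->
    bracket (upd w l (bracket y)) = 0.
  by apply: (main n) => k; [exact/eqP/xS|rewrite leqNgt ltn_ord].
elim: m y => [|m IH] y yS hy.
  have [dy hdy] := homog_degrees (fun k => hy k (leq0n _)).
  have [dw hdw] := homog_degrees hw.
  rewrite (bracket_jacobi _ _ _ _ _ hdw hdy ln) big1 // => i _.
  by rewrite yS bracket0 scaler0.
have [mn|nm] := ltnP m n; last first.
  by apply: IH => // k mk; have := ltn_ord k; rewrite ltnNge (leq_trans nm mk).
pose k0 := Ordinal mn.
have [v0 [v1 [h0 h1 yk0]]] := @homog_dec F n L (y k0).
have : bracket (upd w l (v0 + v1)) = 0 by rewrite -yk0.
move=> /(bracket_homog_eq0 (fun k _ => hw k) h0 h1)[b0 b1].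
rewrite -(upd_id y k0) yk0 !bracketD.
have step v : v \in is_homog -> bracket (upd w l v) = 0 ->
    bracket (upd w l (bracket (upd y k0 v))) = 0.
  move=> hv bv; apply: IH => k; rewrite ffunE; case: eqVneq => // kk0 mk.
  by apply: hy; rewrite ltn_neqAle mk andbT eq_sym.
by rewrite !step ?addr0 //; apply/is_homogP; [exists true|exists false].
Qed.

(** Since [S] contains the center it is a union of cosets, so membership in [S] can be tested in the
    quotient, where its image is a subalgebra. *)
Lemma generates_sub (G : L -> Prop) (S : {pred L}) :
  generates (fun q : center_quot L => exists2 g, G g & q = center_proj g) ->
  sub_superalgebra S -> {subset center L <= S} -> (forall g, G g -> g \in S) ->
  forall v, v \in S.
Proof.
move=> gen [[S0 Slin] Sgr Sbr] ZS GS v.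
have SZ u v' : u \in S -> v' - u \in center L -> v' \in S.
  by move=> uS /ZS h; have := Slin 1 _ _ h uS; rewrite scale1r subrK.
pose SQ : {pred center_quot L} :=
  [pred q | `[< exists2 u, u \in S & q = center_proj u >]].
have SQP q : reflect (exists2 u, u \in S & q = center_proj u) (q \in SQ).
  exact: asboolP.
have piS u : center_proj u \in SQ -> u \in S.
  by move=> /SQP[u' u'S /center_projP]; apply: SZ.
apply: (piS); apply: gen => [|q [g /GS gS ->]]; last by apply/SQP; exists g.
split.
- split=> [|a p q /SQP[u uS ->] /SQP[u' u'S ->]].
    by apply/SQP; exists 0 => //; rewrite linear0.
  by apply/SQP; exists (a *: u + u'); [exact: Slin|rewrite linearP].
- move=> q0 q1 /quot_homogP[v0 h0 ->] /quot_homogP[v1 h1 ->].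
  rewrite -center_projD => /piS /(Sgr _ _ h0 h1)[v0S v1S].
  by split; apply/SQP; [exists v0|exists v1].
- move=> q qS.
  have /choice[u uP] i : exists u, u \in S /\ q i = center_proj u.
    by have /SQP[u uS e] := qS i; exists u.
  apply/SQP; exists (bracket (finfun u)).
    by apply: Sbr => i; rewrite ffunE; case: (uP i).
  rewrite -quot_bracketE -[LHS]/(quot_bracket q); congr quot_bracket.
  by apply/ffunP => i; rewrite !ffunE; case: (uP i).
Qed.

Lemma killed_by_generators_center (G : L -> Prop) z : (2 <= n)%N ->
  generates (fun q : center_quot L => exists2 g, G g & q = center_proj g) ->
  (forall g, G g -> g \in is_homog) -> z \in is_homog ->
  (forall r, size r = n.-1 -> (forall g, g \in r -> G g) ->
     sbracket (z :: r) = 0) ->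
  z \in center L.
Proof.
move=> n2 gen Gh zh zG.
have n0 : (0 < n)%N by apply: leq_trans n2.
have ln : (n.-1 < n)%N by rewrite prednK.
pose l := Ordinal ln.
(* The letters of [us] are arbitrary homogeneous elements, those of [vs] are generators. To free the
   head [u] of [us], it is moved to the last slot: the kernel there contains Z(L), and each
   generator by induction with that generator added to [vs]. *)
have key us vs : all is_homog us -> (forall g, g \in vs -> G g) ->
    size (us ++ vs) = n.-1 -> sbracket (z :: us ++ vs) = 0.
  elim: us vs => [|u us IH] vs; first by move=> _ vsG sz; apply: zG.
  rewrite all_homog_cons => /andP[uh ush] vsG /= sz.
  have vsh : all is_homog vs by apply/allP => g /vsG/Gh.
  pose r := z :: us ++ vs.
  have szr : size r = n.-1 by rewrite -sz.
  have rh : all is_homog r by rewrite all_homog_cons zh all_cat ush vsh.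
  pose w : {ffun 'I_n -> L} := [ffun k : 'I_n => nth 0 r k].
  have wh k : w k \in is_homog.
    rewrite ffunE; have [kr|kr] := ltnP k (size r).
      by apply: (allP rh); apply: mem_nth.
    by rewrite nth_default //; apply/is_homogP; exists false; apply: homog0.
  have rconsE v : bracket (upd w l v) = sbracket (rcons r v).
    rewrite -sbracket_upd; congr bracket; apply/ffunP => k.
    rewrite !ffunE nth_set_nth nth_rcons szr /=.
    by case: ltngtP => // kn; rewrite nth_default // szr ltnW.
  have perm_r v : v \in is_homog ->
      (sbracket (rcons r v) = 0) <-> (sbracket (z :: v :: us ++ vs) = 0).
    move=> vh.
    have pr : perm_eq (rcons r v) (z :: v :: us ++ vs).
      by rewrite -cats1 perm_cons perm_catC.
    have sr : size (rcons r v) = n by rewrite size_rcons szr prednK.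
    have hr : all is_homog (rcons r v) by rewrite all_rcons rh andbT.
    split; apply: sbracket_perm0 => //.
    - by rewrite -(perm_all _ pr).
    - by rewrite -(perm_size pr).
    - by rewrite perm_sym.
  apply/perm_r => //; rewrite -rconsE; apply/eqP.
  have lnS : l.+1 = n by rewrite /= prednK.
  apply: (generates_sub gen (derivation_ker_sub lnS wh)) => [v vZ|g Gg].
    by rewrite inE center_slot.
  rewrite inE rconsE; apply/eqP/perm_r; first exact: Gh.
  apply: (@sbracket_perm0 (z :: us ++ g :: vs)).
  - by rewrite all_homog_cons zh all_cat ush all_homog_cons vsh andbT Gh.
  - by rewrite /= size_cat addnS -size_cat sz prednK.
  - by rewrite perm_cons -cat1s perm_catCA.
  - apply: IH => // [g'|]; last by rewrite size_cat addnS -size_cat.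
    by rewrite inE => /predU1P[->|/vsG].
apply/centerP => x i i0; apply: homog_ext => d w hw.
rewrite bracketE.
case E: (codom _) => [|a c].
  by have := size_codom (upd w i z); rewrite E card_ord => /esym/eqP; rewrite gtn_eqF.
have nE (k : 'I_n) : nth 0 (a :: c) k = upd w i z k.
  by rewrite -E codomE (nth_map k) ?size_enum_ord // nth_ord_enum.
have -> : a = z by have := nE i; rewrite ffunE eqxx i0.
have szc : size c = n.-1.
  by have := size_codom (upd w i z); rewrite E card_ord => /(congr1 predn).
rewrite -[c]cats0; apply: key; rewrite ?cats0 //.
apply/allP => v; have : v \in a :: c -> v \in is_homog.
  rewrite -E => /codomP[k ->]; rewrite ffunE.
  by case: eqP => // _; apply/is_homogP; exists (d k).
by move=> + vc; apply; rewrite inE vc orbT.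
Qed.

(** Exposes the head as a slot, so that linearity and centrality apply; the head 0 on the right is a
    placeholder overwritten by [upd]. *)
Lemma sbracket_head r v (i : 'I_n) : i = 0 :> nat ->
  sbracket (v :: r) = bracket (upd [ffun k : 'I_n => nth 0 (0 :: r) k] i v).
Proof.
move=> i0; congr bracket; apply/ffunP => k; rewrite !ffunE.
case: eqP => [->|/eqP]; first by rewrite i0.
by rewrite -val_eqE /= i0; case: (k : nat).
Qed.

Lemma bracket_derived w : bracket w \in derived L.
Proof.
apply/asboolP; exists 1%N, (fun=> 1), (fun=> w).
by rewrite big_ord1 scale1r.
Qed.

(** Once two copies of [u] stand in front, exchanging them changes the sign of the bracket but not
    its arguments, so twice the bracket is 0. *)
Lemma sbracket_repeat s u : [pchar F] =i pred0 -> (2 <= n)%N ->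
  all is_homog s -> size s = n -> u \in homog false ->
  (1 < count_mem u s)%N -> sbracket s = 0.
Proof.
move=> char0 n2 sh sz u0 us.
have us1 : u \in s by rewrite -has_pred1 has_count ltnW.
have us2 : u \in rem u s.
  by rewrite -has_pred1 has_count count_rem us1 /= eqxx subn_gt0.
pose r := rem u (rem u s).
have pr : perm_eq s [:: u, u & r].
  by rewrite (perm_trans (perm_to_rem us1)) // perm_cons perm_to_rem.
have hr : all is_homog [:: u, u & r] by rewrite -(perm_all _ pr).
have szr : size [:: u, u & r] = n by rewrite -(perm_size pr).
apply: (sbracket_perm0 hr szr); first by rewrite perm_sym.
pose i0 : 'I_n := Ordinal (ltnW n2); pose i1 : 'I_n := Ordinal n2.
set w := [ffun k : 'I_n => nth 0 [:: u, u & r] k].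
have wh k : w k \in is_homog.
  by rewrite ffunE; apply: (allP hr); rewrite mem_nth // szr.
have [d hd] := homog_degrees wh.
(* The degree is forced to be even in the first two slots: for [u = 0] the choice in [d] could be
   odd. *)
pose d' k := if (k == i0) || (k == i1) then false else d k.
have hd' k : w k \in homog (d' k).
  by rewrite /d'; case: ifP => [/orP[]/eqP->|_] //; rewrite ffunE.
have := bracket_skew _ _ i0 i1 hd' erefl.
rewrite {1 2}/d' eqxx /= mul0n expr0 scale1r.
have -> : upd (upd w i0 (w i1)) i1 (w i0) = w.
  by apply/ffunP => k; rewrite !ffunE; do 2![case: eqP => [->|_] //].
move=> /eqP; rewrite -subr_eq0 opprK -mulr2n -scaler_nat scaler_eq0.
have /negPf -> : (2%:R : F) != 0.
  by have := char0 2%N; rewrite !inE /= => ->.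
by move=> /eqP.
Qed.

End Superalgebra.

Arguments is_homog {F n L}.

(** * Normal words: counting and sufficiency *)

(** Grouping by [i], the number of even letters, makes the size literally the sum in the bound.
    Words may coincide when [x] or [y] is not injective; each still contributes a factor. *)
Definition normal_words (T : eqType) (n s t : nat) (x : 'I_s -> T)
    (y : 'I_t -> T) : seq (seq T) :=
  flatten [seq [seq map x (enum A) ++ map y f
               | A : {set 'I_s} <- enum [set A : {set 'I_s} | #|A| == i],
                 f : (n.-1 - i).-tuple 'I_t <- enum {: (n.-1 - i).-tuple 'I_t}]
          | i <- index_iota 0 n].

Lemma size_normal_words (T : eqType) n s t (x : 'I_s -> T) (y : 'I_t -> T) :
  size (normal_words n x y) = (\sum_(0 <= i < n) 'C(s, i) * t ^ (n.-1 - i))%N.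
Proof.
rewrite size_flatten /shape -map_comp sumnE big_map; apply: eq_bigr => i _ /=.
by rewrite size_allpairs -!cardE card_draws card_tuple !card_ord.
Qed.

Lemma mem_normal_words (T : eqType) n s t (x : 'I_s -> T) (y : 'I_t -> T)
    (A : {set 'I_s}) (f : seq 'I_t) :
  (0 < n)%N -> (#|A| + size f)%N = n.-1 ->
  map x (enum A) ++ map y f \in normal_words n x y.
Proof.
move=> n0 sz; apply/flatten_mapP; exists #|A|.
  by rewrite mem_index_iota /= -(prednK n0) ltnS -sz leq_addr.
have szf : size f == (n.-1 - #|A|)%N by rewrite -sz addKn.
by apply/allpairsP; exists (A, Tuple szf); rewrite !mem_enum !inE.
Qed.

Lemma split_word (T : eqType) s t (x : 'I_s -> T) (y : 'I_t -> T) r :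
  (forall g, g \in r -> (exists i, g = x i) \/ (exists j, g = y j)) ->
  exists a b, perm_eq r (map x a ++ map y b).
Proof.
elim: r => [|g r IH] rG; first by exists [::], [::].
have [g' gr|a [b ab]] := IH; first by apply: rG; rewrite inE gr orbT.
have [[i ->]|[j ->]] := rG g (mem_head _ _).
  by exists (i :: a), b; rewrite perm_cons.
by exists a, (j :: b); rewrite /= -(cat1s (y j) (map y b)) perm_sym perm_catCA perm_cons perm_sym.
Qed.

Section Main.
Variables (F : fieldType) (char0 : [pchar F] =i pred0).
Variables (n : nat) (n_ge2 : (2 <= n)%N) (L : nLieSuperalgType F n).
Variables (s t : nat) (x : 'I_s -> L) (y : 'I_t -> L).
Hypothesis x_even : forall i, x i \in homog false.
Hypothesis y_odd : forall j, y j \in homog true.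
Hypothesis xy_gen : generates (fun q : center_quot L =>
  (exists i, q = center_proj (x i)) \/ (exists j, q = center_proj (y j))).

Lemma killed_by_normal_words_center z :
  (forall r, r \in normal_words n x y -> sbracket (z :: r) = 0) ->
  z \in center L.
Proof.
have n0 : (0 < n)%N by apply: leq_trans n_ge2.
have xh i : x i \in is_homog by apply/is_homogP; exists false.
have yh j : y j \in is_homog by apply/is_homogP; exists true.
(* Words consist of homogeneous letters, so the components of [z] are killed separately, by
   parity. *)
suff main v : v \in is_homog ->
    (forall r, r \in normal_words n x y -> sbracket (v :: r) = 0) ->
    v \in center L.
  have [z0 [z1 [h0 h1 ->]]] := @homog_dec F n L z => zW.
  have z01W r : r \in normal_words n x y ->
      sbracket (z0 :: r) = 0 /\ sbracket (z1 :: r) = 0.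
    move=> rW; have := zW r rW; rewrite !(@sbracket_head _ _ _ _ _ (Ordinal n0)) //.
    apply: bracket_homog_eq0 => // k _; rewrite ffunE.
    have [kr|kr] := ltnP k (size (0 :: r)); last first.
      by rewrite nth_default //; apply/is_homogP; exists false; apply: homog0.
    have := mem_nth 0 kr; rewrite inE => /predU1P[->|].
      by apply/is_homogP; exists false; apply: homog0.
    have /flatten_mapP[i _ /allpairsP[[A f] /= [_ _ ->]]] := rW.
    by rewrite mem_cat => /orP[] /mapP[? _ ->].
  rewrite rpredD //; apply: main => [|r rW]; try by case: (z01W r rW).
    by apply/is_homogP; exists false.
  by apply/is_homogP; exists true.
move=> vh vW.
pose G (g : L) := (exists i, g = x i) \/ (exists j, g = y j).
have Gh g : G g -> g \in is_homog by case=> -[i ->].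
apply: (@killed_by_generators_center _ _ _ G) => // [S subS GS|r szr rG].
  apply: xy_gen => // q [] [i ->]; apply: GS.
    by exists (x i) => //; left; exists i.
  by exists (y i) => //; right; exists i.
have [a [b rab]] := split_word rG.
have hr : all (@is_homog F n L) (v :: r).
  by rewrite all_homog_cons vh; apply/allP => g /rG/Gh.
have szvr : size (v :: r) = n by rewrite /= szr prednK.
(* Either an even generator repeats and the bracket vanishes, or the even letters enumerate a subset
   and the word is a permutation of a normal one. *)
have [ua|/negP nua] := boolP (uniq a); last first.
  have [i ai] : exists i, (1 < count_mem i a)%N.
    apply: contrapT => /forallNP na; apply: nua.
    apply: count_mem_uniq => i; rewrite -has_pred1 has_count.
    by move/negP: (na i); case: (count_mem i a) => [|[]].
  apply: (@sbracket_repeat _ _ _ _ (x i)) => //.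
  have /seq.permP -> : perm_eq (v :: r) (v :: map x a ++ map y b) by rewrite perm_cons.
  rewrite /= count_cat count_map; apply: leq_trans (leq_addl _ _).
  apply: leq_trans (leq_addr _ _); apply: (leq_trans ai).
  by apply: sub_count => k /= /eqP->.
have pA : perm_eq a (enum [set i in a]).
  by apply: uniq_perm => // [|i]; rewrite ?enum_uniq // mem_enum inE.
have pr : perm_eq r (map x (enum [set i in a]) ++ map y b).
  by rewrite (perm_trans rab) // perm_cat2r perm_map.
apply: (@sbracket_perm0 _ _ _ (v :: map x (enum [set i in a]) ++ map y b)).
- by rewrite -(perm_all _ (_ : perm_eq (v :: r) _)) // perm_cons.
- by rewrite /= -(perm_size pr).
- by rewrite perm_cons perm_sym.
- apply: vW; apply: mem_normal_words => //.
  by rewrite -szr (perm_size pr) size_cat !size_map -cardE.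
Qed.

End Main.

Theorem theorem4p15 (F : fieldType) (char0 : [pchar F] =i pred0)
    (n : nat) (n_ge2 : (2 <= n)%N) (L : nLieSuperalgType F n)
    (d : nat) (dim_derived : has_dim (derived L) d)
    (fg_quot : finitely_generated (center_quot L))
    (s t : nat) (x : 'I_s -> L) (y : 'I_t -> L)
    (x_even : forall i, x i \in homog false)
    (y_odd : forall j, y j \in homog true)
    (xy_gen : generates (fun q : center_quot L =>
       (exists i, q = center_proj (x i)) \/ (exists j, q = center_proj (y j)))) :
  exists m : nat, has_dim [pred q : center_quot L | true] m /\
    (m <= (\sum_(0 <= i < n) 'C(s, i) * t ^ (n.-1 - i)) * d)%N.
Proof.
have n0 : (0 < n)%N by apply: leq_trans n_ge2.
have [co [co_lin co_inj]] := has_dim_coord dim_derived.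
rewrite -(size_normal_words n x y); set W := normal_words n x y.
(* Row [k] holds the coordinates in L^2 of the bracket of a lift of [q] with the [k]-th normal
   word. *)
pose f (q : center_quot L) : 'rV[F]_(size W * d) :=
  mxvec (\matrix_(k < size W) co (sbracket (center_lift q :: nth [::] W k))).
have f_lin : linear f.
  move=> a p q; rewrite /f -linearP; congr mxvec.
  apply/row_matrixP => k; rewrite linearP /= !rowK -co_lin ?bracket_derived //.
  congr co; rewrite !(@sbracket_head _ _ _ _ _ (Ordinal n0)) // -bracket_linear.
  (* [center_lift] need not be linear, but its defect is central and so is killed by the bracket. *)
  apply/eqP; rewrite -subr_eq0 -scaleN1r addrC -bracket_linear scaleN1r addrC.
  apply/eqP; apply: center_slot; apply/center_projP.
  by rewrite center_liftK linearP /= !center_liftK.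
pose fL : {linear center_quot L -> 'rV[F]_(size W * d)} :=
  HB.pack f (GRing.isLinear.Build _ _ _ _ f f_lin).
apply: (@injective_has_dim _ _ _ fL) => p q /eqP.
rewrite -subr_eq0 -linearB => /eqP fpq; apply/eqP; rewrite -subr_eq0; apply/eqP.
set u := p - q in fpq *; rewrite -[u]center_liftK -(linear0 (@center_proj F n L)).
apply/center_projP; rewrite subr0.
apply: (killed_by_normal_words_center char0 n_ge2 x_even y_odd xy_gen) => r.
move=> /(nthP [::])[k kW <-]; apply: co_inj; first exact: bracket_derived.
have := congr1 (fun M => row (Ordinal kW) (vec_mx M)) fpq.
by rewrite /fL /= /f mxvecK rowK linear0 row0.
Qed.
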